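(* The type $G_2$ coroot lattice is $\check{\mathcal Q}_{G_2}=\check{\mathcal Q}_3=\{q\in\mathbb Z^3:q_1+q_2+q_3=0\}$. The map $q\mapsto\lambda_q$ is a $\widetilde W(G_2)$-equivariant bijection between $\check{\mathcal Q}_{G_2}$ and $3$-cores, where on $3$-cores $s_1$ acts by adding all addable (or removing all removable) boxes of content $1$ mod $3$, $s_0$ acts in the same way on boxes of content $0$ mod $3$, and $s_2$ acts by conjugation. For $\mathbf x\in\check{\mathcal Q}_{G_2}$, $$\check{\mathrm{size}}_i(\mathbf x)=\begin{cases}\mathrm{size}_0(\lambda_{\mathbf x})&\text{if }i=0,\\ \mathrm{size}_0(\lambda_{\mathbf x})+\mathrm{size}_1(\lambda_{\mathbf x})+\mathrm{size}_2(\lambda_{\mathbf x})&\text{if }i=1,\\ 3\,\mathrm{size}_2(\lambda_{\mathbf x})-\mathrm{size}_0(\lambda_{\mathbf x})&\text{if }i=2,\end{cases}$$ and hence $\check{\mathrm{size}}(\mathbf x)=\mathrm{size}(\lambda_{\mathbf x})+3\,\mathrm{size}_2(\lambda_{\mathbf x})$.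
   Context: A $3$-core is an integer partition with no hook of length $3$. For $q\in\check{\mathcal Q}_3$, define a bi-infinite word with positions $p\in\mathbb Z$: write $p=3(\ell-1)+j$ with $\ell\in\mathbb Z$, $1\le j\le 3$, and put $\bullet$ at position $p$ if $\ell\le q_j$, and $\circ$ otherwise. Reading the word in increasing $p$ with $\bullet$ an up-step and $\circ$ a right-step traces, from bottom left to top right, the boundary of a unique partition (English notation); this is $\lambda_q$. (Its parts are the nonzero numbers $\#\{p'<p:\ p'\text{ is }\circ\}$ over positions $p$ carrying $\bullet$.) The content of the box in row $u$, column $v$ is $v-u$; $\mathrm{size}_i(\lambda)$ is the number of boxes of $\lambda$ with content $\equiv i$ mod $3$, and $\mathrm{size}(\lambda)$ is the total number of boxes. Type $G_2$ is realized in the plane orthogonal to $(1,1,1)$ in $\mathbb R^3$, with the standard inner product and simple roots $\alpha_1=(1,-1,0)$ and $\alpha_2=\frac13(-1,2,-1)$. The affine Weyl group $\widetilde W(G_2)$ acts on $\check{\mathcal Q}_{G_2}$ by $s_1(x_1,x_2,x_3)=(x_2,x_1,x_3)$, $s_2(x_1,x_2,x_3)=(-x_3,-x_2,-x_1)$, $s_0(x_1,x_2,x_3)=(x_3+1,x_2,x_1-1)$. Define $\check{\mathrm{size}}_i(\mathbf x)=\langle\frac{c_i}2\mathbf x-\check\omega_i,\mathbf x\rangle$ for $i=0,1,2$ and $\check{\mathrm{size}}=\sum_{i=0}^2\check{\mathrm{size}}_i$, where $\check\omega_0=0$; $\check\omega_1=(1,0,-1)$, $\check\omega_2=(1,1,-2)$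 is the basis dual to the simple roots; and $c_0=1$, $c_1=3$, $c_2=2$. *)

(* Defs.v *)
From mathcomp Require Import all_boot all_order all_algebra.
From mathcomp Require Import zify ring.

Set Implicit Arguments.
Unset Strict Implicit.
Unset Printing Implicit Defensive.

Import Order.TTheory GRing.Theory Num.Theory.

Definition is_partition (sh : seq nat) : bool :=
  sorted geq sh && (0 \notin sh).

(* A box (u, v) is in row u and column v, both counted from 0; contents and
   hook lengths do not depend on this shift. *)
Definition box : Type := (nat * nat)%type.

Definition in_diagram (sh : seq nat) (b : box) : bool :=
  b.2 < nth 0 sh b.1.

Definition boxes (sh : seq nat) : seq box :=
  [seq (u, v) | u <- iota 0 (size sh), v <- iota 0 (nth 0 sh u)].

Definition conj_part (sh : seq nat) : seq nat :=
  [seq count (fun l => v < l) sh | v <- iota 0 (head 0 sh)].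

Definition hook_length (sh : seq nat) (b : box) : nat :=
  let arm := nth 0 sh b.1 - b.2.+1 in
  let leg := nth 0 (conj_part sh) b.2 - b.1.+1 in
  (arm + leg).+1.

Definition is_3core (sh : seq nat) : bool :=
  is_partition sh && all (fun b => hook_length sh b != 3) (boxes sh).

Definition core3 : Type := {sh : seq nat | is_3core sh}.

Definition has_residue (r : nat) (b : box) : bool :=
  (b.2%:Z - b.1%:Z == r%:Z %[mod 3])%Z.

Definition size_res (r : nat) (sh : seq nat) : nat :=
  count (has_residue r) (boxes sh).

Definition size_part (sh : seq nat) : nat := size (boxes sh).

Definition addable (sh : seq nat) (b : box) : bool :=
  [&& ~~ in_diagram sh b,
      (b.1 == 0) || in_diagram sh (b.1.-1, b.2)
    & (b.2 == 0) || in_diagram sh (b.1, b.2.-1)].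

Definition removable (sh : seq nat) (b : box) : bool :=
  [&& in_diagram sh b,
      ~~ in_diagram sh (b.1.+1, b.2)
    & ~~ in_diagram sh (b.1, b.2.+1)].

(* Either no box of residue r is removable and all the addable ones are added,
   or no box of residue r is addable and all the removable ones are removed. If
   there are boxes of neither kind, both clauses say that sh' has the same
   diagram as sh. The relation never holds if there are boxes of both kinds. *)
Definition toggles (r : nat) (sh sh' : seq nat) : Prop :=
  ((forall b, has_residue r b -> ~~ removable sh b) /\
   (forall b, in_diagram sh' b =
      in_diagram sh b || (addable sh b && has_residue r b)))
  \/
  ((forall b, has_residue r b -> ~~ addable sh b) /\
   (forall b, in_diagram sh' b =
      in_diagram sh b && ~~ (removable sh b && has_residue r b))).

Local Open Scope ring_scope.

Definition vec3 (T : nmodType) (a b c : T) : 'rV[T]_3 :=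
  \row_(j < 3) [:: a; b; c]`_j.

Definition Q3 : Type := {q : 'rV[int]_3 | \sum_(j < 3) q 0 j == 0}.

(* The 0-based index inord _ stands for the coordinate j with 1 <= j <= 3 in
   p = 3 (l - 1) + j. *)
Definition bead (q : 'rV[int]_3) (p : int) : bool :=
  let l := ((p - 1) %/ 3)%Z + 1 in
  l <= q 0 (inord `|((p - 1) %% 3)%Z|%N).

Lemma beadE (q : 'rV[int]_3) (l : int) (j : 'I_3) :
  bead q (3 * (l - 1) + (j.+1)%:Z) = (l <= q 0 j).
Proof.
have -> : bead q (3 * (l - 1) + (j.+1)%:Z) =
          bead q (((l - 1) * 3 + j%:Z) + 1).
  by congr bead; lia.
have jlt := ltn_ord j.
rewrite /bead addrK divzMDl // modzMDl.
rewrite (@divz_small j%:Z 3) ?(@modz_small j%:Z 3) ?addr0 ?subrK; try lia.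
by rewrite absz_nat inord_val.
Qed.

(* All the positions outside ]- radius q, radius q] are beads on the left and
   gaps on the right, see bead_left and bead_right below; hence every gap that
   precedes a bead, and every bead that a gap precedes, is in the window. *)
Definition radius (q : 'rV[int]_3) : nat :=
  (3 * \sum_(j < 3) `|q ord0 j|)%N.

Definition window (q : 'rV[int]_3) : seq int :=
  [seq k%:Z - (radius q)%:Z + 1 | k <- iota 0 (radius q).*2].

Lemma bead_left (q : 'rV[int]_3) (p : int) :
  p <= - (radius q)%:Z -> bead q p.
Proof.
rewrite /bead /radius; set j := inord _ => hp.
have : (`|q ord0 j| <= \sum_(j < 3) `|q ord0 j|)%N.
  by rewrite (bigD1 j) //= leq_addr.
move: hp; move: (\sum_(j < 3) _)%N (q ord0 j) => S x.
lia.
Qed.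

Lemma bead_right (q : 'rV[int]_3) (p : int) :
  (radius q)%:Z < p -> ~~ bead q p.
Proof.
rewrite /bead /radius; set j := inord _ => hp.
have : (`|q ord0 j| <= \sum_(j < 3) `|q ord0 j|)%N.
  by rewrite (bigD1 j) //= leq_addr.
move: hp; move: (\sum_(j < 3) _)%N (q ord0 j) => S x.
lia.
Qed.

Definition gaps_before (q : 'rV[int]_3) (p : int) : nat :=
  count (fun p' => (p' < p) && ~~ bead q p') (window q).

(* Going up the boundary from bottom left to top right meets the rows from the
   bottom one to the top one, whence the reversal. *)
Definition lam (q : Q3) : seq nat :=
  [seq n <- [seq gaps_before (val q) p | p <- rev (window (val q))
                                       & bead (val q) p] | n != 0%N].

Section Realization.
Variable R : realFieldType.

Definition dot (u v : 'rV[R]_3) : R := \sum_(j < 3) u 0 j * v 0 j.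

Definition alpha1 : 'rV[R]_3 := vec3 1 (-1) 0.
Definition alpha2 : 'rV[R]_3 := 3^-1 *: vec3 (-1) 2 (-1).

Definition coroot (a : 'rV[R]_3) : 'rV[R]_3 := (2 / dot a a) *: a.

Definition reflection (a v : 'rV[R]_3) : 'rV[R]_3 := v - dot v a *: coroot a.

Inductive root_G2 : 'rV[R]_3 -> Prop :=
| root_alpha1 : root_G2 alpha1
| root_alpha2 : root_G2 alpha2
| root_reflection1 a : root_G2 a -> root_G2 (reflection alpha1 a)
| root_reflection2 a : root_G2 a -> root_G2 (reflection alpha2 a).

(* The subgroup generated by the coroots. *)
Inductive coroot_lattice_G2 : 'rV[R]_3 -> Prop :=
| coroot_lattice0 : coroot_lattice_G2 0
| coroot_lattice_coroot a : root_G2 a -> coroot_lattice_G2 (coroot a)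
| coroot_latticeB u v :
    coroot_lattice_G2 u -> coroot_lattice_G2 v -> coroot_lattice_G2 (u - v).

Definition embed (q : Q3) : 'rV[R]_3 := map_mx intr (val q).

Definition c_G2 (i : 'I_3) : R := [:: 1; 3; 2]`_i.

Definition omega (i : 'I_3) : 'rV[R]_3 :=
  [:: 0; vec3 1 0 (-1); vec3 1 1 (-2)]`_i.

Definition csize_i (i : 'I_3) (x : Q3) : R :=
  dot ((c_G2 i / 2) *: embed x - omega i) (embed x).

Definition csize (x : Q3) : R := \sum_(i < 3) csize_i i x.

End Realization.

Definition gen_vec (i : 'I_3) (x : 'rV[int]_3) : 'rV[int]_3 :=
  [:: vec3 (x 0 2 + 1) (x 0 1) (x 0 0 - 1);
      vec3 (x 0 1) (x 0 0) (x 0 2);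
      vec3 (- x 0 2) (- x 0 1) (- x 0 0)]`_i.

Lemma sum3E (T : nmodType) (x : 'rV[T]_3) :
  \sum_(j < 3) x 0 j = x 0 0 + x 0 1 + x 0 2.
Proof.
rewrite !big_ord_recl big_ord0 addr0 addrA.
by congr (_ + x _ _ + x _ _); apply/val_inj.
Qed.

Lemma vec3_sum (T : nmodType) (a b c : T) :
  \sum_(j < 3) vec3 a b c 0 j = a + b + c.
Proof. by rewrite sum3E !mxE. Qed.

Lemma gen_subproof (i : 'I_3) (q : Q3) :
  \sum_(j < 3) gen_vec i (val q) 0 j == 0.
Proof.
case: q => x /= /eqP; rewrite sum3E => hx; apply/eqP.
by case: i => [[|[|[|//]]] hi]; rewrite /gen_vec /= vec3_sum;
  move: (x 0 0) (x 0 1) (x 0 2) hx => a b c; lia.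
Qed.

Definition gen (i : 'I_3) (q : Q3) : Q3 :=
  exist (fun x : 'rV[int]_3 => \sum_(j < 3) x 0 j == 0) _ (gen_subproof i q).

Lemma row3P (T : nmodType) (u v : 'rV[T]_3) :
  u 0 0 = v 0 0 -> u 0 1 = v 0 1 -> u 0 2 = v 0 2 -> u = v.
Proof.
move=> h0 h1 h2; apply/rowP => -[[|[|[|//]]] hj].
- by rewrite (_ : Ordinal hj = 0) //; apply/val_inj.
- by rewrite (_ : Ordinal hj = 1) //; apply/val_inj.
- by rewrite (_ : Ordinal hj = 2) //; apply/val_inj.
Qed.

Lemma dotE (R : realFieldType) (u v : 'rV[R]_3) :
  dot u v = u 0 0 * v 0 0 + u 0 1 * v 0 1 + u 0 2 * v 0 2.
Proof.
rewrite /dot !big_ord_recl big_ord0 addr0 addrA.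
by congr (u _ _ * v _ _ + u _ _ * v _ _ + u _ _ * v _ _); apply/val_inj.
Qed.

Lemma embed_sum (R : realFieldType) (q : Q3) :
  embed R q 0 0 + embed R q 0 1 + embed R q 0 2 = 0.
Proof.
case: q => x hx; rewrite /embed /= !mxE -!rmorphD /=.
by move: hx; rewrite sum3E => /eqP ->.
Qed.

Lemma embed_gen0 (R : realFieldType) (q : Q3) :
  let theta := vec3 1 0 (-1) in
  embed R (gen 0 q) = reflection theta (embed R q) + coroot theta.
Proof.
move=> theta; rewrite /theta.
apply: row3P; rewrite /reflection /coroot !dotE /embed /= !mxE /=
  ?intrD ?intrB ?intrN; by field.
Qed.

Lemma embed_gen1 (R : realFieldType) (q : Q3) :
  embed R (gen 1 q) = reflection (alpha1 R) (embed R q).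
Proof.
apply: row3P; rewrite /reflection /coroot !dotE /embed /= !mxE /=; by field.
Qed.

Lemma embed_gen2 (R : realFieldType) (q : Q3) :
  embed R (gen 2 q) = reflection (alpha2 R) (embed R q).
Proof.
have hq : embed R q 0 1 = - embed R q 0 0 - embed R q 0 2.
  by apply/eqP; rewrite -subr_eq0 -(embed_sum R q); apply/eqP; ring.
move: hq; rewrite !mxE /= => hq.
apply: row3P; rewrite /reflection /coroot !dotE /embed /= !mxE /= ?intrN hq;
  by field.
Qed.

(* The affine Weyl group as a group of transformations of the coroot lattice,
   on which it acts faithfully. It is closed under inverses because the
   generators are involutions. *)
Inductive affine_weyl_G2 : (Q3 -> Q3) -> Prop :=
| affine_weyl_id : affine_weyl_G2 id
| affine_weyl_gen i g : affine_weyl_G2 g -> affine_weyl_G2 (gen i \o g).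

Definition is_weyl_action (T : Type) (rho : (Q3 -> Q3) -> T -> T) : Prop :=
  [/\ forall g h, affine_weyl_G2 g -> affine_weyl_G2 h ->
        g =1 h -> rho g =1 rho h,
      rho id =1 id
    & forall g h, affine_weyl_G2 g -> affine_weyl_G2 h ->
        rho (g \o h) =1 rho g \o rho h].

(* Main.v *)
Require Import Defs.
From mathcomp Require Import all_boot all_order all_algebra.
From mathcomp Require Import zify ring.
Import Order.TTheory GRing.Theory Num.Theory.
Local Open Scope ring_scope.

(** Everything about partitions is read off the bead word, through the sequence
    [beta sh u = sh_u - u] of the positions of its beads from right to left. Two
    facts carry the proof. First, a strictly decreasing integer sequence is
    determined by its set of values ([enumerates_unique]), so a partition is
    determined by its bead word. Second, the beads of [lam q] are the positions
    that satisfy [bead q] ([lam_enumerates]): the number of gaps before the bead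
    number [u] is its position plus [u], because the coordinates of [q] add up
    to 0.

    Bijectivity. A box whose row ends at the bead [p] and whose column ends at
    the gap [p'] has hook length [p - p'], so a partition is a 3-core exactly when
    its bead set is closed under [p - 3] ([is_3coreP]). Such a set is a choice of
    a level on each of the three residue classes of positions, that is, a vector
    [q]; the coordinates of [q] add up to 0 because the bead [beta sh u] is
    [- u] for large [u] ([lam_surj]).

    Equivariance. On bead words, [s_0] and [s_1] exchange the positions [p] and
    [p + 1] for all [p] congruent to 0, respectively 1, modulo 3. Since the
    levels of two runners are comparable, all beads that move do so in the same
    direction, which adds all addable boxes of that residue or removes all
    removable ones ([toggles_residue_swap]). The generator [s_2] reverses the word
    and exchanges beads and gaps, as conjugation does ([enumerates_conj_part]). The
    action of the whole group on cores is then the one transported along the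
    bijection, which is automatically an action.

    Sizes. Row [u] contains the contents from [- u] to [beta sh u - 1], so the
    number of boxes of residue [r] is a sum over the beads of a floor function,
    compared with the empty partition. Summing over the three runners gives
    [|q|^2 / 2] plus a partial sum of the coordinates ([size_res_lam]), and the
    formulas follow by expanding the scalar products.

    Coroots. The simple reflections preserve the integral points, hence all
    coroots are integral; conversely the two simple coroots span the integral
    points of the plane ([coroot_latticeP]). *)

(** * Partitions as decreasing sequences of beads *)

(** Up to a shift, the classical beta-numbers: row [u], counted from the top,
    is the up-step of the boundary at position [beta sh u]. Its last box
    has content [beta sh u - 1], and a box appended to it has content
    [beta sh u]. *)
Definition beta (sh : seq nat) (u : nat) : int := (nth 0%N sh u)%:Z - u%:Z.

(** A bead word in which all far-left positions are beads and all far-right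
    ones are gaps is handled through the decreasing list of its beads. *)
Definition enumerates (f : nat -> int) (B : int -> bool) : Prop :=
  (forall u v, (u < v)%N -> f v < f u) /\ (forall p, B p <-> exists u, f u = p).

(** The induction step of [enumerates_unique]: [f n] is a value [g m], and [m < n]
    is excluded because [g m = f m] is larger than [f n]. *)
Lemma enumerates_le f g B n :
  enumerates f B -> enumerates g B ->
  (forall m, (m < n)%N -> f m = g m) -> f n <= g n.
Proof.
move=> [fdec fB] [gdec gB] IH.
have /gB [m gm] : B (f n) by apply/fB; exists n.
case: (ltngtP m n) => [mn|nm|mn]; last by rewrite -gm mn.
- by have := fdec _ _ mn; rewrite (IH m) // gm ltxx.
- by rewrite -gm ltW // gdec.
Qed.

(** This uniqueness turns every identity between partitions below into an
    identity between bead words. *)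
Lemma enumerates_unique f g B :
  enumerates f B -> enumerates g B -> f =1 g.
Proof.
move=> hf hg n; elim/ltn_ind: n => n IH.
apply/le_anti/andP; split; first exact: enumerates_le hf hg IH.
by apply: enumerates_le hg hf _ => m /IH.
Qed.

Lemma enumerates_ext f g B : f =1 g -> enumerates f B -> enumerates g B.
Proof.
move=> e [dec im]; split=> [u v|p]; first by rewrite -!e; apply: dec.
by rewrite im; split=> -[u <-]; exists u; rewrite e.
Qed.

Lemma nth_partition sh u v :
  is_partition sh -> (u <= v)%N -> (nth 0 sh v <= nth 0 sh u)%N.
Proof.
move=> /andP[hs _] uv; case: (ltnP v (size sh)) => hv; last by rewrite nth_default.
have geq_trans : transitive geq by move=> a b c /= h1 h2; apply: leq_trans h1.
by apply: (sorted_leq_nth geq_trans (leqnn) 0%N hs); rewrite ?inE //; lia.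
Qed.

Lemma partition_nth_inj s t :
  is_partition s -> is_partition t -> nth 0%N s =1 nth 0%N t -> s = t.
Proof.
have le a b : is_partition b -> nth 0%N a =1 nth 0%N b -> (size b <= size a)%N.
  move=> /andP[_ h0] e; rewrite leqNgt; apply/negP => lt.
  by move: h0; rewrite -(nth_default 0%N (leqnn (size a))) e mem_nth.
move=> hs ht e; apply: (@eq_from_nth _ 0%N) => [|i _]; last exact: e.
apply/eqP; rewrite eqn_leq (le t s) ?(le s t) //.
Qed.

Lemma beta_decreasing sh u v :
  is_partition sh -> (u < v)%N -> beta sh v < beta sh u.
Proof.
by move=> hp uv; have := nth_partition sh u v hp (ltnW uv); rewrite /beta; lia.
Qed.

Lemma partition_enumerates_inj s t B :
  is_partition s -> is_partition t ->
  enumerates (beta s) B -> enumerates (beta t) B -> s = t.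
Proof.
move=> hs ht es et; apply: partition_nth_inj => // u.
by have := enumerates_unique _ _ _ es et u; rewrite /beta; lia.
Qed.

(** * Addable and removable boxes on the bead word *)

Section Corners.
Variables (sh : seq nat) (B : int -> bool).
Hypotheses (hp : is_partition sh) (hB : enumerates (beta sh) B).

Lemma enumerates_bead u : B (beta sh u).
Proof. by apply/(hB.2); exists u. Qed.

(** Adding a box at the end of row [u] moves its bead one step to the right;
    the box is addable exactly when the next position is free, the bead above
    being the only one that could block it. *)
Lemma addableE u v :
  addable sh (u, v) = (v == nth 0%N sh u) && ~~ B (beta sh u + 1).
Proof.
case: hB => dec im; rewrite /addable /in_diagram /=.
case: u => [|u] /=.
  have -> : B (beta sh 0 + 1) = false.
    apply/negP => /im [[|w]]; first lia.
    by have := dec 0%N w.+1 isT; lia.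
  by rewrite andbT; case: v => [|v] /=; lia.
have mon := nth_partition sh u u.+1 hp (leqnSn u).
have -> : B (beta sh u.+1 + 1) = (nth 0 sh u.+1 == nth 0 sh u)%N.
  apply/idP/eqP => [/im [w ew]|e]; last first.
    by apply/im; exists u; rewrite /beta; lia.
  have wu : (w <= u)%N.
    by rewrite leqNgt; apply/negP => uw; case: (ltngtP w u.+1) => [|/dec|ee];
      [lia | lia | move: ew; rewrite ee; lia].
  have : beta sh u <= beta sh w.
    by case: (ltngtP w u) => [/dec| |->]; [lia | lia |].
  by rewrite ew /beta; lia.
by case: v => [|v] /=; lia.
Qed.

Lemma removableE u v :
  removable sh (u, v) = (v.+1 == nth 0%N sh u) && ~~ B (beta sh u - 1).
Proof.
case: hB => dec im; rewrite /removable /in_diagram /=.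
have mon := nth_partition sh u u.+1 hp (leqnSn u).
have -> : B (beta sh u - 1) = (nth 0 sh u.+1 == nth 0 sh u)%N.
  apply/idP/eqP => [/im [w ew]|e]; last first.
    by apply/im; exists u.+1; rewrite /beta; lia.
  have wu : (u < w)%N.
    by rewrite ltnNge; apply/negP => uw; case: (ltngtP w u) => [/dec| |ee];
      [lia | lia | move: ew; rewrite ee; lia].
  have : beta sh w <= beta sh u.+1.
    by case: (ltngtP w u.+1) => [|/dec|->]; [lia | lia |].
  by rewrite ew /beta; lia.
by lia.
Qed.

(** The transposition of the positions [p] and [p + 1], for all
    [p = r mod 3] at once. *)
Definition residue_swap (r : nat) (p : int) : int :=
  if (p == r%:Z %[mod 3])%Z then p + 1
  else if (p - 1 == r%:Z %[mod 3])%Z then p - 1 else p.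

(** If no pair [p, p + 1] with [p = r mod 3] reads gap-bead, then no box of
    residue [r] is removable, and swapping the pairs moves each bead of a
    bead-gap pair one step to the right. No bead overtakes another one, so
    row [u] of the new partition is row [u] of the old one, with a box appended
    if its bead has moved. *)
Lemma toggle_add (r : nat) sh' :
  is_partition sh' -> enumerates (beta sh') (B \o residue_swap r) ->
  (forall p, (p == r%:Z %[mod 3])%Z -> B (p + 1) -> B p) ->
  toggles r sh sh'.
Proof.
move=> hp' hB' mono; left; split=> [[u v] hr|[u v]].
  rewrite removableE; apply/negP => /andP[/eqP ev].
  rewrite (_ : beta sh u - 1 = v%:Z - u%:Z); last by rewrite /beta; lia.
  rewrite mono //; rewrite (_ : _ + 1 = beta sh u) ?enumerates_bead //.
  by rewrite /beta; lia.
(* The bead of row w after the swap. *)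
pose g w := beta sh w + ((beta sh w == r%:Z %[mod 3])%Z && ~~ B (beta sh w + 1))%:Z.
have eg : beta sh' =1 g.
  apply: enumerates_unique hB' _.
  have [dec im] := hB; split=> [a b ab|p].
    have := dec _ _ ab; rewrite /g => lt.
    case: (eqVneq (beta sh b + 1) (beta sh a)) => [->|]; last by lia.
    by rewrite enumerates_bead andbF; lia.
  rewrite /= /residue_swap /g; case: ifP => [hr|hr]; last case: ifP => hr1.
  - split=> [hb|[w hw]].
      have /im [w hw] := mono _ hr hb.
      by exists w; rewrite hw hb andbF addr0.
    move: hw; case: (boolP (B (beta sh w + 1))) => hb.
      by rewrite andbF addr0 => hw; rewrite -hw.
    by move: hr; rewrite andbT => hr; case: (boolP (_ == _)) => /= hr2 hw; lia.
  - split=> [hb|[w hw]].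
      case: (boolP (B p)) => hb1.
        by have /im [w hw] := hb1; exists w; rewrite hw hr addr0.
      by have /im [w hw] := hb; exists w; rewrite hw hr1 subrK hb1; lia.
    move: hw; case: (boolP (_ && _)) => h hw.
      by rewrite -hw addrK enumerates_bead.
    apply: (mono _ hr1); rewrite subrK -hw addr0; exact: enumerates_bead.
  - split=> [/im [w hw]|[w hw]]; first by exists w; rewrite hw hr addr0.
    move: hw; case: (boolP (_ && _)) => h hw; last by
      rewrite -hw addr0; exact: enumerates_bead.
    by move: h hr1 => /andP[h _]; rewrite -hw addrK h.
rewrite addableE /in_diagram /=.
have := eg u; rewrite /g /has_residue /=; case: (eqVneq v (nth 0%N sh u)) => [->|ne].
  rewrite -/(beta sh u) /=; move: (~~ _) => c.
  by move: (_ == _) => d; rewrite /beta; case: d; case: c => /=; lia.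
by move: (_ && ~~ _) => d; rewrite /beta; case: d => /=; lia.
Qed.

(** The mirror image of [toggle_add]: here no pair reads bead-gap, and the beads
    of the gap-bead pairs move one step to the left. *)
Lemma toggle_remove (r : nat) sh' :
  is_partition sh' -> enumerates (beta sh') (B \o residue_swap r) ->
  (forall p, (p == r%:Z %[mod 3])%Z -> B p -> B (p + 1)) ->
  toggles r sh sh'.
Proof.
move=> hp' hB' mono; right; split=> [[u v] hr|[u v]].
  rewrite addableE; apply/negP => /andP[/eqP ev].
  rewrite mono ?enumerates_bead //.
  by rewrite (_ : beta sh u = v%:Z - u%:Z) // /beta; lia.
(* The bead of row w after the swap. *)
pose g w := beta sh w
  - ((beta sh w - 1 == r%:Z %[mod 3])%Z && ~~ B (beta sh w - 1))%:Z.
have eg : beta sh' =1 g.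
  apply: enumerates_unique hB' _.
  have [dec im] := hB; split=> [a b ab|p].
    have := dec _ _ ab; rewrite /g => lt.
    case: (eqVneq (beta sh a - 1) (beta sh b)) => [->|]; last by lia.
    by rewrite enumerates_bead andbF; lia.
  rewrite /= /residue_swap /g; case: ifP => [hr|hr]; last case: ifP => hr1.
  - split=> [hb|[w hw]].
      case: (boolP (B p)) => hb1.
        have /im [w hw] := hb1; exists w; rewrite hw.
        by rewrite (_ : _ == _ = false) ?subr0 //; lia.
      by have /im [w hw] := hb; exists w; rewrite hw addrK hr hb1; lia.
    move: hw; case: (boolP (_ && _)) => h hw.
      by rewrite -hw subrK enumerates_bead.
    by apply: (mono _ hr); rewrite -hw subr0; exact: enumerates_bead.
  - split=> [hb|[w hw]].
      have := mono _ hr1 hb; rewrite subrK => /im [w hw].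
      by exists w; rewrite hw hb andbF subr0.
    move: hw; case: (boolP (B (beta sh w - 1))) => hb.
      by rewrite andbF subr0 => hw; rewrite -hw.
    by rewrite andbT; case: (boolP (_ == _)) => /= hr2 hw; lia.
  - split=> [/im [w hw]|[w hw]]; first by exists w; rewrite hw hr1 subr0.
    move: hw; case: (boolP (_ && _)) => h hw; last by
      rewrite -hw subr0; exact: enumerates_bead.
    by move: h hr => /andP[h _]; rewrite -hw h.
rewrite removableE /in_diagram /=.
have := eg u; rewrite /g /has_residue /=; case: (eqVneq v.+1 (nth 0%N sh u)) => [e|ne].
  rewrite (_ : v%:Z - u%:Z = beta sh u - 1) /=; last by rewrite /beta; lia.
  move: (~~ _) => c.
  by move: (_ == _) => d; rewrite /beta; case: d; case: c => /=; lia.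
by move: (_ && ~~ _) => d; rewrite /beta; case: d => /=; lia.
Qed.

End Corners.

Lemma toggles_residue_swap (r : nat) sh sh' (B : int -> bool) :
  is_partition sh -> enumerates (beta sh) B ->
  is_partition sh' -> enumerates (beta sh') (B \o residue_swap r) ->
  (forall p, (p == r%:Z %[mod 3])%Z -> B (p + 1) -> B p) \/
  (forall p, (p == r%:Z %[mod 3])%Z -> B p -> B (p + 1)) ->
  toggles r sh sh'.
Proof.
move=> hp hB hp' hB'.
by case=> mono;
  [exact: toggle_add hp hB _ _ hp' hB' mono
  | exact: toggle_remove hp hB _ _ hp' hB' mono].
Qed.

(** * Conjugation, gaps and hooks *)

Lemma lt_count_partition sh u v :
  is_partition sh -> (u < count (fun l => v < l) sh)%N = (v < nth 0 sh u)%N.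
Proof.
move=> /andP[hs _]; elim: sh u hs => [|x sh IH] u //= hs; first by rewrite nth_nil.
have geq_trans : transitive geq by move=> a b c /= h1 h2; apply: leq_trans h1.
have xs := order_path_min geq_trans hs.
have {IH} IH := IH _ (path_sorted hs).
case: (ltnP v x) => vx; first by case: u => [|u] //=; rewrite add1n ltnS IH.
have -> : count (fun l => v < l)%N sh = 0%N.
  apply/eqP; rewrite -leqn0 leqNgt -has_count; apply/negP => /hasP[y ys vy].
  by have := allP xs _ ys; rewrite /=; lia.
case: u => [|u] /=; first by lia.
case: (ltnP u (size sh)) => hu; last by rewrite nth_default //; lia.
by have := allP xs _ (mem_nth 0%N hu) => /=; lia.
Qed.

Lemma nth_conj_part sh v :
  is_partition sh -> nth 0%N (conj_part sh) v = count (fun l => v < l)%N sh.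
Proof.
move=> hp; rewrite /conj_part.
case: (ltnP v (head 0%N sh)) => hv.
  by rewrite (nth_map 0%N) ?size_iota // nth_iota // add0n.
rewrite nth_default ?size_map ?size_iota //; apply/esym/eqP.
by rewrite -leqn0 leqNgt (lt_count_partition _ _ _ hp) nth0 -leqNgt.
Qed.

Lemma lt_nth_conj_part sh u v :
  is_partition sh -> (u < nth 0 (conj_part sh) v)%N = (v < nth 0 sh u)%N.
Proof. by move=> hp; rewrite nth_conj_part // lt_count_partition. Qed.

Lemma conj_part_partition sh : is_partition sh -> is_partition (conj_part sh).
Proof.
move=> hp; apply/andP; split.
  apply/(sortedP 0%N) => i _; rewrite /= leqNgt; apply/negP.
  set k := nth _ _ i; rewrite lt_nth_conj_part // => h.
  have : (k < k)%N by rewrite {2}/k lt_nth_conj_part //; apply: ltnW.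
  by rewrite ltnn.
apply/mapP => -[v]; rewrite mem_iota add0n => /andP[_ hv] e.
by have := lt_count_partition sh 0 v hp; rewrite -e nth0 hv.
Qed.

(** The right-step of the boundary under column [v]: the columns of a partition
    are to the gaps of its bead word what the rows are to the beads. *)
Definition gap_pos (sh : seq nat) (v : nat) : int :=
  v%:Z + 1 - (nth 0%N (conj_part sh) v)%:Z.

Section Core.
Variables (sh : seq nat) (B : int -> bool).
Hypotheses (hp : is_partition sh) (hB : enumerates (beta sh) B).

Lemma gap_pos_lt_beta u v : (gap_pos sh v < beta sh u) = (v < nth 0 sh u)%N.
Proof.
have := lt_nth_conj_part sh u v hp; rewrite /gap_pos /beta.
by case: (ltnP v) => h1; case: (ltnP u) => h2 //; lia.
Qed.

(** For [p] not a bead, let [u] be the number of beads to the right of [p]: rows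
    [0, ..., u - 1] are those that reach column [p + u - 1], so this column
    has its right-step at [p]. *)
Lemma gap_posP p : ~~ B p <-> exists v, gap_pos sh v = p.
Proof.
split=> [nb|[v <-]]; last first.
  apply/negP => /(hB.2) [u]; have := lt_nth_conj_part sh u v hp.
  by rewrite /beta /gap_pos; lia.
have ex : exists u, beta sh u <= p.
  exists (size sh + absz p)%N; rewrite /beta nth_default ?leq_addr //; lia.
case: (ex_minnP ex) => u hu min.
have neu : beta sh u != p.
  by apply: contra nb => /eqP <-; exact: enumerates_bead hB _.
have hpu : (0 < p + u%:Z) by move: hu neu; rewrite /beta; lia.
exists (absz (p + u%:Z - 1)%R); set v := absz _.
suff : nth 0%N (conj_part sh) v = u by rewrite /gap_pos; lia.
apply/eqP; rewrite eqn_leq leqNgt lt_nth_conj_part //.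
have -> : ~~ (v < nth 0 sh u)%N by move: hu neu; rewrite /beta; lia.
case: u hu min neu hpu @v => [|u] // hu min neu hpu v.
rewrite lt_nth_conj_part //.
have : ~~ (beta sh u <= p) by apply/negP => /min; rewrite ltnn.
have : (beta sh u != p).
  by apply: contra nb => /eqP <-; exact: enumerates_bead hB _.
by rewrite /beta; lia.
Qed.

(** The hook of a box joins the right-step under its column to the up-step at
    the end of its row. *)
Lemma hook_lengthE u v : (v < nth 0 sh u)%N ->
  (hook_length sh (u, v))%:Z = beta sh u - gap_pos sh v.
Proof.
move=> h; have := lt_nth_conj_part sh u v hp; rewrite h.
by rewrite /hook_length /= /beta /gap_pos; lia.
Qed.

(** By [hook_lengthE], a hook of length 3 is a bead at [p] together with a gap
    at [p - 3]. *)
Lemma is_3coreP : is_3core sh <-> forall p, B p -> B (p - 3).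
Proof.
rewrite /is_3core hp /=; split=> [/allP h p bp|h].
  apply/negP => /negP/gap_posP [v ev].
  have [u eu] := (hB.2 p).1 bp.
  have hv : (v < nth 0 sh u)%N by rewrite -gap_pos_lt_beta ev eu; lia.
  have := h (u, v); rewrite -[_ != _]/(_ != _).
  case/(_ _)/negP.
    apply/allpairsPdep; exists u, v; split => //; rewrite mem_iota add0n //=.
    by rewrite ltnNge; apply/negP => hs; move: hv; rewrite nth_default.
  by have := hook_lengthE _ _ hv; rewrite ev eu; lia.
apply/allP => b /allpairsPdep [u [v [_]]]; rewrite mem_iota add0n /= => hv ->.
apply/negP => /eqP e3; have := hook_lengthE _ _ hv; rewrite e3 => e.
have : ~~ B (gap_pos sh v) by apply/gap_posP; exists v.
have -> : gap_pos sh v = beta sh u - 3 by lia.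
by rewrite h //; exact: enumerates_bead hB _.
Qed.

(** Conjugation reflects the boundary, hence exchanges beads and gaps and
    reverses the positions. *)
Lemma enumerates_conj_part :
  enumerates (beta (conj_part sh)) (fun p => ~~ B (1 - p)).
Proof.
have hc := conj_part_partition _ hp.
split=> [u v|p]; first exact: beta_decreasing.
by rewrite gap_posP; split=> -[v ev]; exists v; move: ev; rewrite /gap_pos /beta; lia.
Qed.

End Core.

(** * Beads in the window *)

Definition height (q : 'rV[int]_3) : nat := (\sum_(j < 3) `|q ord0 j|)%N.

Lemma height_ge (q : 'rV[int]_3) j : (absz (q 0 j)%R <= height q)%N.
Proof. by rewrite /height (bigD1 j) //= leq_addr. Qed.

Lemma sum_runners n (G : nat -> int) :
  \sum_(0 <= k < 3 * n) G k = \sum_(j < 3) \sum_(0 <= m < n) G (3 * m + j)%N.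
Proof.
elim: n => [|n IH]; first by rewrite muln0 big_geq // big1 // => j _; rewrite big_geq.
rewrite (_ : 3 * n.+1 = (3 * n).+3)%N; last by lia.
rewrite !big_nat_recr //= {}IH.
rewrite [RHS](eq_bigr (fun j : 'I_3 =>
  \sum_(0 <= m < n) G (3 * m + j)%N + G (3 * n + j)%N)); last first.
  by move=> j _; rewrite big_nat_recr.
rewrite big_split /= -!addrA; congr (_ + _).
by rewrite !big_ord_recl big_ord0 /= /bump /= addr0 addn0 addn1 addn2.
Qed.

(** The beads of the window on the runner [j] are at the levels from
    [1 - height q] to [q 0 j]: this is where the coordinates of [q] enter every
    count of beads. *)
Lemma sum_bead_window (q : 'rV[int]_3) (F : int -> int) :
  \sum_(p <- window q | bead q p) F p =
  \sum_(j < 3) \sum_(0 <= m < absz (q 0 j + (height q)%:Z))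
    F (3 * (m%:Z - (height q)%:Z) + j.+1%:Z).
Proof.
have rE : radius q = (3 * height q)%N by [].
rewrite /window big_map big_mkcond /=.
rewrite (_ : (radius q).*2 = 3 * (height q).*2 - 0)%N; last by rewrite rE; lia.
rewrite -/(index_iota 0 _) sum_runners; apply: eq_bigr => j _.
have hj := height_ge q j.
rewrite [RHS](big_nat_widen _ _ (height q).*2); last by lia.
rewrite [RHS]big_mkcond; apply: eq_big_nat => m hm.
rewrite rE (_ : (_ - _ + 1 : int)
  = 3 * (m%:Z - (height q)%:Z + 1 - 1) + j.+1%:Z); last by lia.
rewrite beadE addrK.
by congr (if _ then _ else _); lia.
Qed.

Definition bead_seq (q : 'rV[int]_3) : seq int :=
  [seq p <- rev (window q) | bead q p].

Lemma mem_window q p : (p \in window q) = (- (radius q)%:Z < p <= (radius q)%:Z).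
Proof.
apply/mapP/idP => [[k]|h]; first by rewrite mem_iota; lia.
by exists (absz (p + (radius q)%:Z - 1)%R); rewrite ?mem_iota; lia.
Qed.

Lemma mem_bead_seq q p : (p \in bead_seq q) = bead q p && (- (radius q)%:Z < p).
Proof.
rewrite mem_filter mem_rev mem_window.
case: (boolP (bead q p)) => //= hb.
case: (leP p (radius q)%:Z) => h; rewrite ?andbT ?andbF //.
by have := bead_right h; rewrite hb.
Qed.

Lemma window_sorted q : sorted <%R (window q).
Proof.
apply/(sortedP 0) => i; rewrite size_map size_iota => hi.
by rewrite !(nth_map 0%N) ?size_iota ?nth_iota //; lia.
Qed.

Lemma bead_seq_sorted q : sorted >%R (bead_seq q).
Proof.
apply: sorted_filter; first by move=> a b c h1 h2; apply: lt_trans h1.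
by rewrite rev_sorted; exact: window_sorted.
Qed.

Lemma count_sum (T : Type) (P : pred T) (s : seq T) :
  (count P s)%:Z = \sum_(x <- s | P x) 1.
Proof.
elim: s => [|x s IH] /=; first by rewrite big_nil.
by rewrite big_cons PoszD IH; case: (P x) => //=; rewrite add0r.
Qed.

(** The sum of the coordinates is the charge of the word: its number of beads,
    compared with the word of the empty partition. *)
Lemma size_bead_seq q :
  (size (bead_seq q))%:Z = (radius q)%:Z + \sum_(j < 3) q 0 j.
Proof.
rewrite size_filter count_rev count_sum.
rewrite (sum_bead_window q (fun=> 1)).
rewrite (eq_bigr (fun j => q 0 j + (height q)%:Z)); last first.
  move=> j _; have := height_ge q j.
  by rewrite big_const_nat iter_addr_0 subn0; lia.
by rewrite big_split /= sumr_const card_ord addrC; congr (_ + _);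
  rewrite /radius -/(height q); lia.
Qed.

(** The beads of the window from right to left, then all the positions to the
    left of the window. It makes sense for coordinates of any sum, which is
    what allows a vanishing charge to be proved for the word of a partition. *)
Definition bead_enum (q : 'rV[int]_3) (u : nat) : int :=
  if (u < size (bead_seq q))%N then nth 0 (bead_seq q) u
  else (size (bead_seq q))%:Z - (radius q)%:Z - u%:Z.

Lemma bead_enumP q : enumerates (bead_enum q) (bead q).
Proof.
have memn u : (u < size (bead_seq q))%N ->
    bead q (nth 0 (bead_seq q) u) && (- (radius q)%:Z < nth 0 (bead_seq q) u).
  by move=> hu; rewrite -mem_bead_seq mem_nth.
split=> [u v uv|p].
  rewrite /bead_enum; case: ifP => hv.
    rewrite (ltn_trans uv hv).
    have tr : transitive (>%R : rel int) by move=> a b c h1 h2; apply: lt_trans h1.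
    by apply: (sorted_ltn_nth tr 0 (bead_seq_sorted q)); rewrite ?inE //; lia.
  case: ifP => hu; last by lia.
  by have /andP[_] := memn _ hu; lia.
split=> [hb|[u <-]].
  case: (ltrP (- (radius q)%:Z) p) => hp.
    have hin : p \in bead_seq q by rewrite mem_bead_seq hb.
    by exists (index p (bead_seq q)); rewrite /bead_enum index_mem hin nth_index.
  exists (absz ((size (bead_seq q))%:Z - (radius q)%:Z - p)%R).
  by rewrite /bead_enum ifF; lia.
rewrite /bead_enum; case: ifP => hu; first by have /andP[] := memn _ hu.
by apply: bead_left; lia.
Qed.

Lemma count_below_nth (s : seq int) i :
  sorted >%R s -> (i < size s)%N ->
  count (fun p => p < nth 0 s i) s = (size s - i.+1)%N.
Proof.
elim: s i => [|x s IH] i //= hs hi.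
have tr : transitive (>%R : rel int) by move=> a b c h1 h2; apply: lt_trans h1.
have /allP xs := order_path_min tr hs.
case: i hi => [|i] hi /=.
  rewrite ltxx add0n subn1 /=; apply/eqP; rewrite -all_count.
  by apply/allP => y /xs.
rewrite IH ?(path_sorted hs) //.
have /= lt := xs _ (mem_nth 0 hi).
by rewrite ltNge (ltW lt) subSS.
Qed.

Lemma count_window_lt q p :
  - (radius q)%:Z < p <= (radius q)%:Z ->
  (count (fun p' => p' < p) (window q))%:Z = p + (radius q)%:Z - 1.
Proof.
move=> h; rewrite /window count_map.
set a := absz (p + (radius q)%:Z - 1)%R.
rewrite (@eq_count _ _ (fun k => k < a)%N); last by move=> k /=; lia.
rewrite (_ : (radius q).*2 = a + ((radius q).*2 - a))%N; last by lia.
rewrite iotaD count_cat.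
have /eqP -> : count (fun k => k < a)%N (iota 0 a) == size (iota 0 a).
  by rewrite -all_count; apply/allP => k; rewrite mem_iota.
rewrite (_ : count _ (iota (0 + a) _) = 0%N) ?size_iota; first by lia.
apply/eqP; rewrite -leqn0 leqNgt -has_count; apply/hasP => -[k].
by rewrite mem_iota; lia.
Qed.

(** Before the bead number [i] of the window there are [size - i - 1] beads
    inside the window, and the gaps are the other positions. *)
Lemma gaps_before_bead q i : (i < size (bead_seq q))%N ->
  (gaps_before q (nth 0 (bead_seq q) i))%:Z =
  nth 0 (bead_seq q) i + i%:Z + ((radius q)%:Z - (size (bead_seq q))%:Z).
Proof.
move=> hi; set p := nth _ _ _.
have : p \in bead_seq q by rewrite mem_nth.
rewrite mem_filter mem_rev mem_window => /andP[_] hp.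
have := count_window_lt _ _ hp.
have := count_below_nth _ _ (bead_seq_sorted q) hi; rewrite -/p.
rewrite count_filter count_rev => count_below.
have split_count (s : seq int) : count (fun p' => p' < p) s =
    (count (predI (fun p' => p' < p)%R (bead q)) s +
     count (fun p' => (p' < p)%R && ~~ bead q p') s)%N.
  by elim: s => //= x s ->; case: (x < p); case: (bead q x) => /=; lia.
rewrite split_count PoszD -/(gaps_before q p).
by rewrite [count (predI _ _) _]count_below; lia.
Qed.

(** * The partition of a lattice point *)

Lemma Q3_sum (q : Q3) : val q 0 0 + val q 0 1 + val q 0 2 = 0.
Proof. by rewrite -sum3E; apply/eqP; exact: valP q. Qed.

Lemma size_bead_seq_Q3 (q : Q3) : size (bead_seq (val q)) = radius (val q).
Proof.
have := size_bead_seq (val q); rewrite (eqP (valP q)); lia.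
Qed.

(** The zeros of a weakly decreasing sequence are at its end, so that removing
    them does not move the other entries, and [nth] reads the default value 0
    where they were. *)
Lemma nth_filter_neq0 (s : seq nat) u :
  sorted geq s -> nth 0%N [seq n <- s | n != 0%N] u = nth 0%N s u.
Proof.
elim: s u => [|x s IH] u //= hs.
have tr : transitive geq by move=> a b c /= h1 h2; apply: leq_trans h1.
have /allP xs := order_path_min tr hs.
case: (eqVneq x 0%N) => [x0|nx] /=; last first.
  by case: u => [|u] //=; rewrite IH ?(path_sorted hs).
have s0 y : y \in s -> y = 0%N by move=> /xs /=; lia.
rewrite IH ?(path_sorted hs) // x0.
have n0 w : nth 0%N s w = 0%N.
  by case: (ltnP w (size s)) => hw; [apply/s0/mem_nth | rewrite nth_default].
by case: u => [|u] /=; rewrite !n0.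
Qed.

Section Lam.
Variable q : Q3.

Lemma nth_gaps u :
  (nth 0%N [seq gaps_before (val q) p | p <- bead_seq (val q)] u)%:Z
  = bead_enum (val q) u + u%:Z.
Proof.
have sz := size_bead_seq_Q3 q.
rewrite /bead_enum; case: ifP => hu; last first.
  by rewrite nth_default ?size_map; lia.
by rewrite (nth_map 0) // gaps_before_bead //; lia.
Qed.

Lemma gaps_sorted :
  sorted geq [seq gaps_before (val q) p | p <- bead_seq (val q)].
Proof.
have [dec _] := bead_enumP (val q).
apply/(sortedP 0%N) => i _ /=.
by rewrite -lez_nat !nth_gaps; have := dec i i.+1 (leqnn _); lia.
Qed.

Lemma lam_partition : is_partition (lam q).
Proof.
apply/andP; split; last by rewrite mem_filter.
apply: sorted_filter gaps_sorted.
by move=> a b c /= h1 h2; apply: leq_trans h1.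
Qed.

Lemma beta_lam : beta (lam q) =1 bead_enum (val q).
Proof.
move=> u; rewrite /beta /lam nth_filter_neq0; last exact: gaps_sorted.
by rewrite nth_gaps addrK.
Qed.

Lemma lam_enumerates : enumerates (beta (lam q)) (bead (val q)).
Proof.
by apply: enumerates_ext (bead_enumP _) => u; rewrite beta_lam.
Qed.

End Lam.

(** * The generators on bead words *)

Lemma position_runner (p : int) : exists (l : int) (j : 'I_3), p = 3 * (l - 1) + j.+1%:Z.
Proof.
have h := @ltz_pmod (p - 1) 3 isT; have h0 := @modz_ge0 (p - 1) 3 isT.
have hj : (absz ((p - 1) %% 3)%Z < 3)%N by lia.
by exists (((p - 1) %/ 3)%Z + 1), (Ordinal hj) => /=; lia.
Qed.

Lemma bead_flush x p : bead x p -> bead x (p - 3).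
Proof.
have [l [j ->]] := position_runner p.
rewrite beadE (_ : _ - 3 = 3 * ((l - 1) - 1) + j.+1%:Z); last by lia.
by rewrite beadE; lia.
Qed.

Lemma bead_inj x y : bead x =1 bead y -> x = y.
Proof.
move=> e; apply/rowP => j.
have := e (3 * (x 0 j - 1) + j.+1%:Z); have := e (3 * (y 0 j - 1) + j.+1%:Z).
by rewrite !beadE !lexx; lia.
Qed.

Lemma ord3P (j : 'I_3) : [\/ j = 0, j = 1 | j = 2].
Proof.
case: j => -[|[|[|//]]] hj; [apply: Or31 | apply: Or32 | apply: Or33];
  exact/val_inj.
Qed.

Lemma bead_at x p (l : int) (j : 'I_3) :
  p = 3 * (l - 1) + j.+1%:Z -> bead x p = (l <= x 0 j).
Proof. by move=> ->; exact: beadE. Qed.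

(** Position [3 l] is on the last runner and position [3 l + 1] on the first one,
    one level up: this is the shift by one in the action of [s_0]. *)
Lemma bead_gen0 x p : bead (gen_vec 0 x) p = bead x (residue_swap 0 p).
Proof.
have [l [j ->]] := position_runner p; rewrite beadE /gen_vec /residue_swap.
case: (ord3P j) => ->; rewrite mxE /=.
- rewrite ifF; last by lia.
  rewrite ifT; last by lia.
  by rewrite (bead_at _ _ (l - 1) 2) /=; lia.
- rewrite ifF; last by lia.
  rewrite ifF; last by lia.
  by rewrite (bead_at _ _ l 1) /=; lia.
- rewrite ifT; last by lia.
  by rewrite (bead_at _ _ (l + 1) 0) /=; lia.
Qed.

Lemma bead_gen1 x p : bead (gen_vec 1 x) p = bead x (residue_swap 1 p).
Proof.
have [l [j ->]] := position_runner p; rewrite beadE /gen_vec /residue_swap.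
case: (ord3P j) => ->; rewrite mxE /=.
- rewrite ifT; last by lia.
  by rewrite (bead_at _ _ l 1) /=; lia.
- rewrite ifF; last by lia.
  rewrite ifT; last by lia.
  by rewrite (bead_at _ _ l 0) /=; lia.
- rewrite ifF; last by lia.
  rewrite ifF; last by lia.
  by rewrite (bead_at _ _ l 2) /=; lia.
Qed.

Lemma bead_gen2 x p : bead (gen_vec 2 x) p = ~~ bead x (1 - p).
Proof.
have [l [j ->]] := position_runner p; rewrite beadE /gen_vec.
case: (ord3P j) => ->; rewrite mxE /=.
- by rewrite (bead_at _ _ (1 - l) 2) /=; lia.
- by rewrite (bead_at _ _ (1 - l) 1) /=; lia.
- by rewrite (bead_at _ _ (1 - l) 0) /=; lia.
Qed.

(** Each runner is filled up to one level, so the bead sets of two runners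
    are nested, one way or the other. *)
Lemma adjacent_runners_nested1 x :
  (forall p, (p == 1%N%:Z %[mod 3])%Z -> bead x (p + 1) -> bead x p) \/
  (forall p, (p == 1%N%:Z %[mod 3])%Z -> bead x p -> bead x (p + 1)).
Proof.
case: (lerP (x 0 1) (x 0 0)) => h; [left|right] => p hp;
  have e : p = 3 * (((p - 1) %/ 3)%Z + 1 - 1) + (0%R : 'I_3).+1%:Z by rewrite /=; lia.
all: have e1 : p + 1 =
  3 * (((p - 1) %/ 3)%Z + 1 - 1) + (1%R : 'I_3).+1%:Z by rewrite /=; lia.
all: by rewrite (bead_at _ _ _ _ e) (bead_at _ _ _ _ e1); lia.
Qed.

Lemma adjacent_runners_nested0 x :
  (forall p, (p == 0%N%:Z %[mod 3])%Z -> bead x (p + 1) -> bead x p) \/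
  (forall p, (p == 0%N%:Z %[mod 3])%Z -> bead x p -> bead x (p + 1)).
Proof.
case: (lerP (x 0 0 - 1) (x 0 2)) => h; [left|right] => p hp;
  have e : p = 3 * ((p %/ 3)%Z - 1) + (2%R : 'I_3).+1%:Z by rewrite /=; lia.
all: have e1 : p + 1 = 3 * ((p %/ 3)%Z + 1 - 1) + (0%R : 'I_3).+1%:Z by rewrite /=; lia.
all: by rewrite (bead_at _ _ _ _ e) (bead_at _ _ _ _ e1); lia.
Qed.

Lemma enumerates_eq f B C : B =1 C -> enumerates f B -> enumerates f C.
Proof. by move=> e [dec im]; split=> // p; rewrite -e. Qed.

Lemma toggles_lam0 q : toggles 0 (lam q) (lam (gen 0 q)).
Proof.
apply: toggles_residue_swap (lam_partition _) (lam_enumerates _)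
  (lam_partition _) _ (adjacent_runners_nested0 _).
by apply: enumerates_eq (lam_enumerates _) => p; rewrite bead_gen0.
Qed.

Lemma toggles_lam1 q : toggles 1 (lam q) (lam (gen 1 q)).
Proof.
apply: toggles_residue_swap (lam_partition _) (lam_enumerates _)
  (lam_partition _) _ (adjacent_runners_nested1 _).
by apply: enumerates_eq (lam_enumerates _) => p; rewrite bead_gen1.
Qed.

Lemma lam_gen2 q : lam (gen 2 q) = conj_part (lam q).
Proof.
apply: partition_enumerates_inj (lam_enumerates _) _.
- exact: lam_partition.
- exact/conj_part_partition/lam_partition.
apply: enumerates_eq (enumerates_conj_part _ _ (lam_partition q) (lam_enumerates q)).
by move=> p; rewrite bead_gen2.
Qed.

Lemma lam_3core q : is_3core (lam q).
Proof.
by apply/(is_3coreP _ _ (lam_partition q) (lam_enumerates q)); exact: bead_flush.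
Qed.

Lemma lam_inj q q' : lam q = lam q' -> q = q'.
Proof.
move=> e; apply/val_inj/bead_inj => p; apply/idP/idP.
  by move=> /(lam_enumerates q).2; rewrite e => /(lam_enumerates q').2.
by move=> /(lam_enumerates q').2; rewrite -e => /(lam_enumerates q).2.
Qed.

(** * Every 3-core comes from a lattice point *)

Lemma down_closed_threshold (b : int -> bool) (a : int) (n : nat) :
  (forall l, b l -> b (l - 1)) -> b a -> ~~ b (a + n%:Z) ->
  exists x, forall l, b l = (l <= x).
Proof.
move=> down; elim: n a => [|n IH] a ha hn; first by rewrite addr0 ha in hn.
case: (boolP (b (a + 1))) => ha1.
  by apply: IH ha1 _; rewrite -addrA -PoszD add1n.
have downn k l : b l -> b (l - k%:Z).
  elim: k => [|k IHk]; first by rewrite subr0.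
  by move=> /IHk /down; rewrite -addrA -opprD -PoszD addn1.
exists a => l; apply/idP/idP => [bl|la].
  rewrite leNgt; apply: contra ha1 => al.
  by rewrite (_ : a + 1 = l - (absz (l - a - 1)%R)%:Z); [apply: downn | lia].
by rewrite (_ : l = a - (absz (a - l)%R)%:Z); [apply: downn | lia].
Qed.

(** In rows beyond [size sh] the bead is [- u], so row [u] with
    [beta sh u = p] is found among the first [size sh + |p| + 1]. *)
Definition maya (sh : seq nat) (p : int) : bool :=
  has (fun u => beta sh u == p) (iota 0 (size sh + absz p).+1).

Lemma maya_enumerates sh : is_partition sh -> enumerates (beta sh) (maya sh).
Proof.
move=> hp; split=> [u v|p]; first exact: beta_decreasing.
split=> [/hasP[u _ /eqP] <-|[u e]]; first by exists u.
apply/hasP; exists u; last by rewrite e.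
rewrite mem_iota /=; case: (ltnP u (size sh)) => hu; first by lia.
by move: e; rewrite /beta nth_default //; lia.
Qed.

(** The word of a 3-core is closed under [p - 3], so each of its runners is filled
    up to a level [x j]. Comparing two descriptions of the beads far to the left,
    [- u] and [bead_enum x u], shows that the levels add up to 0. *)
Lemma lam_surj c : is_3core c -> exists q, lam q = c.
Proof.
move=> hc; have hp : is_partition c by case/andP: hc.
have hm := maya_enumerates c hp.
have /(is_3coreP _ _ hp hm) flush := hc.
have thr (j : 'I_3) : exists x, forall l : int, maya c (3 * (l - 1) + j.+1%:Z) = (l <= x).
  have hj := ltn_ord j.
  apply: (@down_closed_threshold _ (- (size c)%:Z) (size c + (head 0 c) + 1)%N).
  - move=> l /flush; congr (maya c _); lia.
  - apply/(hm.2); exists (absz (3 * (size c)%:Z + 2 - j%:Z)%R).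
    by rewrite /beta nth_default; lia.
  - apply/negP => /(hm.2) [u].
    by have := nth_partition c 0 u hp (leq0n u); rewrite /beta nth0; lia.
have [x0 hx0] := thr 0; have [x1 hx1] := thr 1; have [x2 hx2] := thr 2.
pose x := vec3 x0 x1 x2.
have bx : maya c =1 bead x.
  move=> p; have [l [j ->]] := position_runner p; rewrite beadE.
  by case: (ord3P j) => ->; rewrite mxE /=.
have eb : beta c =1 bead_enum x.
  by apply: enumerates_unique (enumerates_eq _ _ _ bx hm) (bead_enumP x).
have hx : \sum_(j < 3) x 0 j == 0.
  have := eb (size c + size (bead_seq x))%N.
  rewrite /beta nth_default ?leq_addr // /bead_enum ifF; last by lia.
  rewrite size_bead_seq => e; apply/eqP.
  by move: (\sum_(j < 3) _) e => s; lia.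
exists (exist (fun x : 'rV[int]_3 => \sum_(j < 3) x 0 j == 0) x hx).
apply: partition_enumerates_inj (lam_enumerates _) _ => //; first exact: lam_partition.
exact: enumerates_eq bx hm.
Qed.

(** * Counting boxes by residue *)

(** A primitive of the indicator of the residue class [r]: it grows by 1 from
    [n] to [n + 1] exactly when [n = r mod 3]. *)
Definition residue_floor (r : nat) (n : int) : int := ((n - r%:Z + 2) %/ 3)%Z.

(** The contents of the boxes of row [u] are [- u, ..., n - u - 1]. *)
Lemma count_row_residue (r u n : nat) :
  (count (fun v => has_residue r (u, v)) (iota 0 n))%:Z =
  residue_floor r (n%:Z - u%:Z) - residue_floor r (- u%:Z).
Proof.
elim: n => [|n IH]; first by rewrite sub0r subrr.
rewrite -addn1 iotaD count_cat PoszD {}IH /= add0n addn0.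
by rewrite /has_residue /residue_floor /=; lia.
Qed.

Lemma count_allpairs_dep (S T : Type) (P : pred (S * T)) (s : seq S) (t : S -> seq T) :
  (count P [seq (x, y) | x <- s, y <- t x])%:Z =
  \sum_(x <- s) (count (fun y => P (x, y)) (t x))%:Z.
Proof.
elim: s => [|x s IH]; first by rewrite big_nil.
by rewrite big_cons -IH /= count_cat count_map PoszD.
Qed.

Lemma size_res_sum (r M : nat) sh : (size sh <= M)%N ->
  (size_res r sh)%:Z =
  \sum_(0 <= u < M) (residue_floor r (beta sh u) - residue_floor r (- u%:Z)).
Proof.
move=> hM; rewrite /size_res /boxes count_allpairs_dep.
rewrite -[X in iota 0 X]subn0 -/(index_iota 0 (size sh)).
rewrite [RHS](@big_cat_nat _ _ _ (size sh)) //= [X in _ + X]big1_seq ?addr0.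
  by apply: eq_bigr => u _; rewrite count_row_residue.
move=> u /andP[_]; rewrite mem_index_iota => /andP[hu _].
by rewrite /beta nth_default // sub0r subrr.
Qed.

Lemma residue_floorM r l i : residue_floor r (3 * l + i) = l + residue_floor r i.
Proof. by rewrite /residue_floor; lia. Qed.

Lemma double_sum_shift (n : nat) (d : int) :
  2 * (\sum_(0 <= m < n) (m%:Z + d)) = n%:Z * (n%:Z - 1 + 2 * d).
Proof.
elim: n => [|n IH]; first by rewrite big_geq // mulr0 mul0r.
rewrite big_nat_recr //= mulrDr IH.
rewrite (_ : n.+1%:Z = n%:Z + 1); last by lia.
ring.
Qed.

Lemma size_lam_le (q : Q3) : (size (lam q) <= radius (val q))%N.
Proof.
rewrite size_filter (leq_trans (count_size _ _)) // size_map -/(bead_seq _).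
by rewrite size_bead_seq_Q3.
Qed.

Lemma sum_beads_lam (q : Q3) (F : int -> int) :
  \sum_(0 <= u < radius (val q)) F (beta (lam q) u) =
  \sum_(j < 3) \sum_(0 <= m < absz (val q 0 j + (height (val q))%:Z))
    F (3 * (m%:Z - (height (val q))%:Z) + j.+1%:Z).
Proof.
rewrite -sum_bead_window -[RHS]big_filter.
rewrite (perm_big (bead_seq (val q))); last first.
  by rewrite /bead_seq filter_rev perm_sym perm_rev.
rewrite [RHS](big_nth 0) size_bead_seq_Q3; apply: eq_big_nat => u /= hu.
by rewrite beta_lam /bead_enum size_bead_seq_Q3 hu.
Qed.

(** By [size_res_sum], the number of boxes of residue [r] is the sum of
    [residue_floor r] over the beads of the word minus the same sum for the
    empty partition. Both are computed runner by runner, as sums of arithmetic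
    progressions; the result is
    [|q|^2 / 2 - (q_1 + ... + q_r)] with coordinates numbered from 1, which
    [|q|^2 / 2 + (q_(r+1) + ... + q_3)] equals on the lattice. *)
Lemma size_res_lam (r : nat) (q : Q3) : (r < 3)%N ->
  2 * (size_res r (lam q))%:Z =
  \sum_(j < 3) (val q 0 j ^+ 2 + 2 * (val q 0 j *+ (r <= j)%N)).
Proof.
move=> hr; rewrite (size_res_sum _ _ _ (size_lam_le q)) sumrB mulrBr sum_beads_lam.
set h := height (val q).
have -> : radius (val q) = (3 * h)%N by [].
rewrite (sum_runners h (fun u => residue_floor r (- u%:Z))).
rewrite !mulr_sumr -sumrB.
have floor_row (j : 'I_3) : residue_floor r j.+1%:Z = (r <= j)%N%:Z.
  by have := ltn_ord j; rewrite /residue_floor; lia.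
have floor_vac (j : 'I_3) : residue_floor r (3 - j%:Z) = (r + j <= 2)%N%:Z.
  by have := ltn_ord j; rewrite /residue_floor; lia.
(* Runner j of the word, up to the level of its last bead. *)
have rowE (j : 'I_3) :
  2 * (\sum_(0 <= m < absz (val q 0 j + h%:Z))
     residue_floor r (3 * (m%:Z - h%:Z) + j.+1%:Z))
  = (val q 0 j + h%:Z) * (val q 0 j - h%:Z - 1 + 2 * (r <= j)%N%:Z).
  rewrite (eq_bigr (fun m : nat => m%:Z + ((r <= j)%N%:Z - h%:Z))); last first.
    by move=> m _; rewrite residue_floorM ?floor_row ?floor_vac; ring.
  have := height_ge (val q) j; rewrite -/h double_sum_shift => hj.
  have -> : (absz (val q 0 j + h%:Z)%R)%:Z = val q 0 j + h%:Z by lia.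
  ring.
(* The same for the empty partition, whose beads are 0, -1, -2, etc. *)
have vacE (j : 'I_3) :
  2 * (\sum_(0 <= m < h) residue_floor r (- (3 * m + j)%N%:Z))
  = - (h%:Z * (h%:Z + 1 - 2 * (r + j <= 2)%N%:Z)).
  rewrite (eq_bigr (fun m : nat => - (m%:Z + (1 - (r + j <= 2)%N%:Z)))); last first.
    move=> m _; rewrite (_ : - _ = 3 * (- m%:Z - 1) + (3 - j%:Z)); last by lia.
    by rewrite residue_floorM ?floor_row ?floor_vac; ring.
  rewrite sumrN mulrN double_sum_shift; ring.
rewrite (eq_bigr _ (fun j _ => congr2 (fun a b => a - b) (rowE j) (vacE j))).
have := Q3_sum q; rewrite !big_ord_recl !big_ord0 /= /bump /=.
have -> : lift ord0 (ord0 : 'I_2) = 1 :> 'I_3 by apply/val_inj.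
have -> : lift ord0 (lift ord0 (ord0 : 'I_1)) = 2 :> 'I_3 by apply/val_inj.
move: (val q 0 0) (val q 0 1) (val q 0 2) => a b c e.
have -> : a = - b - c by lia.
by case: r hr {floor_row floor_vac rowE vacE} => [|[|[|]]] //= _; ring.
Qed.

Lemma size_part_res sh :
  size_part sh = (size_res 0 sh + size_res 1 sh + size_res 2 sh)%N.
Proof.
rewrite /size_part /size_res; elim: (boxes sh) => //= b s ->.
by rewrite /has_residue; lia.
Qed.

(** * The coroot lattice *)

Section Lattice.
Variable R : realFieldType.

Lemma dot_reflection (a u : 'rV[R]_3) :
  dot a a != 0 -> dot (reflection a u) (reflection a u) = dot u u.
Proof.
rewrite /reflection /coroot !dotE !mxE => h; field.
exact: h.
Qed.

Lemma coroot_reflection (a b : 'rV[R]_3) :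
  dot a a != 0 -> coroot (reflection a b) = reflection a (coroot b).
Proof.
move=> h; rewrite {1}/coroot dot_reflection // /coroot.
move: (2 / dot b b) => k.
by apply: row3P; rewrite /reflection /coroot !dotE !mxE; ring.
Qed.

Lemma dot_alpha1 : dot (alpha1 R) (alpha1 R) = 2.
Proof. by rewrite dotE !mxE /=; ring. Qed.

Lemma dot_alpha2 : dot (alpha2 R) (alpha2 R) = 2 / 3.
Proof. by rewrite dotE !mxE /=; field. Qed.

Lemma Q3P (a b c : int) : a + b + c = 0 ->
  exists q : Q3, val q = vec3 a b c.
Proof.
move=> h; have h' : \sum_(j < 3) vec3 a b c 0 j == 0 by rewrite vec3_sum h.
by exists (exist (fun x : 'rV[int]_3 => \sum_(j < 3) x 0 j == 0) _ h').
Qed.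

Lemma coroot_alpha1E : coroot (alpha1 R) = vec3 1 (-1) 0.
Proof.
by rewrite /coroot dot_alpha1 divff ?scale1r // pnatr_eq0.
Qed.

Lemma coroot_alpha2E : coroot (alpha2 R) = vec3 (-1) 2 (-1).
Proof.
by rewrite /coroot dot_alpha2; apply: row3P; rewrite !mxE /=; field.
Qed.

(** The coroots of the simple roots are integral, and the simple reflections act
    on coroots as the generators [s_1] and [s_2] do on the integral points. *)
Lemma coroot_integral a : root_G2 a -> exists q : Q3, coroot a = embed R q.
Proof.
have n1 : dot (alpha1 R) (alpha1 R) != 0 by rewrite dot_alpha1 pnatr_eq0.
have n2 : dot (alpha2 R) (alpha2 R) != 0.
  by rewrite dot_alpha2 mulf_neq0 ?invr_eq0 ?pnatr_eq0.
elim=> [||b _ [q eq]|b _ [q eq]].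
- have [q eq] := Q3P 1 (-1) 0 erefl; exists q.
  by rewrite coroot_alpha1E /embed eq; apply: row3P; rewrite !mxE.
- have [q eq] := Q3P (-1) 2 (-1) erefl; exists q.
  by rewrite coroot_alpha2E /embed eq; apply: row3P; rewrite !mxE.
- by exists (gen 1 q); rewrite coroot_reflection // eq embed_gen1.
- by exists (gen 2 q); rewrite coroot_reflection // eq embed_gen2.
Qed.

Lemma coroot_latticeD u v :
  @coroot_lattice_G2 R u -> coroot_lattice_G2 v -> coroot_lattice_G2 (u + v).
Proof.
move=> hu hv; rewrite -[v]opprK; apply: coroot_latticeB => //.
by rewrite -sub0r; apply: coroot_latticeB => //; exact: coroot_lattice0.
Qed.

Lemma coroot_latticeMz u (n : int) :
  @coroot_lattice_G2 R u -> coroot_lattice_G2 (u *~ n).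
Proof.
move=> hu.
have hn (k : nat) : coroot_lattice_G2 (u *+ k).
  elim: k => [|k IH]; first by rewrite mulr0n; exact: coroot_lattice0.
  by rewrite mulrS; apply: coroot_latticeD.
case: n => n; first exact: hn.
rewrite NegzE mulrNz -sub0r; apply: coroot_latticeB; first exact: coroot_lattice0.
exact: hn.
Qed.

(** The coroots [(1, -1, 0)] and [(-1, 2, -1)] of the simple roots form a basis
    of the integral points of the plane. *)
Lemma coroot_latticeP (v : 'rV[R]_3) :
  coroot_lattice_G2 v <-> exists q : Q3, v = embed R q.
Proof.
split=> [|[q ->]].
  elim=> [|a /coroot_integral //|u w _ [p ->] _ [q ->]].
    have [q eq] := Q3P 0 0 0 erefl; exists q.
    by rewrite /embed eq; apply: row3P; rewrite !mxE.
  have hs : \sum_(j < 3) (val p - val q) 0 j == 0.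
    rewrite (eq_bigr (fun j => val p 0 j - val q 0 j)); last by move=> j _; rewrite !mxE.
    by rewrite sumrB (eqP (valP p)) (eqP (valP q)) subrr.
  exists (exist (fun x : 'rV[int]_3 => \sum_(j < 3) x 0 j == 0) _ hs).
  by rewrite /embed map_mxB.
have e : embed R q = coroot (alpha1 R) *~ (2 * val q 0 0 + val q 0 1)
                     + coroot (alpha2 R) *~ (val q 0 0 + val q 0 1).
  have h2 : val q 0 2 = - val q 0 0 - val q 0 1.
    have := Q3_sum q; move: (val q 0 0) (val q 0 1) (val q 0 2); lia.
  rewrite -!scaler_int coroot_alpha1E coroot_alpha2E.
  by apply: row3P; rewrite /embed !mxE /= ?h2 !rmorphD ?rmorphN ?rmorphM /=; ring.
rewrite e; apply: coroot_latticeD; apply: coroot_latticeMz;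
  apply: coroot_lattice_coroot; [exact: root_alpha1 | exact: root_alpha2].
Qed.

End Lattice.

(** * The size formulas and the theorem *)

Section Sizes.
Variables (R : realFieldType) (x : Q3).

Lemma size_resE (r : nat) : (r < 3)%N ->
  (size_res r (lam x))%:R = 2^-1 * dot (embed R x) (embed R x)
    + \sum_(j < 3) embed R x 0 j *+ (r <= j)%N.
Proof.
move=> hr; apply: (@mulfI _ (2 : R)); first by rewrite pnatr_eq0.
rewrite mulrDr mulrA divff ?pnatr_eq0 // mul1r.
have /(congr1 (fun z : int => z%:~R : R)) := size_res_lam _ x hr.
rewrite rmorphM /= -pmulrn => ->.
rewrite rmorph_sum mulr_sumr -big_split /=; apply: eq_bigr => j _.
by rewrite /embed mxE expr2 rmorphD !rmorphM rmorphMn /=; ring.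
Qed.

Lemma csize_formulas :
  [/\ csize_i R 0 x = (size_res 0%N (lam x))%:R,
      csize_i R 1 x = (size_res 0%N (lam x))%:R
                      + (size_res 1%N (lam x))%:R
                      + (size_res 2%N (lam x))%:R
    & csize_i R 2 x = 3 * (size_res 2%N (lam x))%:R
                      - (size_res 0%N (lam x))%:R].
Proof.
rewrite !size_resE //.
have hsum (r : nat) : \sum_(j < 3) embed R x 0 j *+ (r <= j)%N
    = embed R x 0 0 *+ (r <= 0)%N + embed R x 0 1 *+ (r <= 1)%N
      + embed R x 0 2 *+ (r <= 2)%N.
  rewrite !big_ord_recl big_ord0 addr0 addrA.
  by congr (_ *+ _ + embed R x _ _ *+ _ + embed R x _ _ *+ _); apply/val_inj.
rewrite !hsum /= /csize_i !dotE /c_G2 /omega !mxE /=.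
have := embed_sum R x; rewrite /embed !mxE.
move: (_%:~R) (_%:~R) (_%:~R) => a b c e.
have -> : b = - a - c by rewrite -[LHS]subr0 -e; ring.
by split; field.
Qed.

End Sizes.

Definition core_of (q : Q3) : core3 :=
  exist (fun sh => is_3core sh) (lam q) (lam_3core q).

Lemma core_of_bij : bijective core_of.
Proof.
(* Q3 is unfolded so that xchoose finds the choice structure of the subtype. *)
have ex (c : core3) : exists q : {x : 'rV[int]_3 | \sum_(j < 3) x 0 j == 0},
    lam q == val c.
  by have [q eq] := lam_surj _ (valP c); exists q; rewrite eq.
exists (fun c => xchoose (ex c)) => [q|c]; last first.
  by apply/val_inj/eqP; exact: xchooseP (ex c).
by apply/lam_inj/eqP; exact: xchooseP (ex (core_of q)).
Qed.

Theorem theorem5p5 (R : realFieldType) :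
  (forall v : 'rV[R]_3,
     coroot_lattice_G2 v <-> exists q : Q3, v = embed R q) /\
  (exists (phi : Q3 -> core3) (rho : (Q3 -> Q3) -> core3 -> core3),
     [/\ (forall q : Q3, val (phi q) = lam q),
         bijective phi,
         is_weyl_action rho,
         (forall c : core3,
            [/\ toggles 0%N (val c) (val (rho (gen 0) c)),
                toggles 1%N (val c) (val (rho (gen 1) c))
              & val (rho (gen 2) c) = conj_part (val c)])
       & (forall (g : Q3 -> Q3) (q : Q3),
            affine_weyl_G2 g -> phi (g q) = rho g (phi q))]) /\
  (forall x : Q3,
     [/\ csize_i R 0 x = (size_res 0%N (lam x))%:R,
         csize_i R 1 x = (size_res 0%N (lam x))%:R
                         + (size_res 1%N (lam x))%:R
                         + (size_res 2%N (lam x))%:R,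
         csize_i R 2 x = 3 * (size_res 2%N (lam x))%:R
                         - (size_res 0%N (lam x))%:R
       & csize R x = (size_part (lam x))%:R
                     + 3 * (size_res 2%N (lam x))%:R]).
Proof.
split; first exact: coroot_latticeP.
split; last first.
  move=> x; have [e0 e1 e2] := csize_formulas R x; split=> //.
  have -> : csize R x = csize_i R 0 x + csize_i R 1 x + csize_i R 2 x.
    rewrite /csize !big_ord_recl big_ord0 addr0 addrA.
    by congr (csize_i R _ x + csize_i R _ x + csize_i R _ x); apply/val_inj.
  by rewrite e0 e1 e2 size_part_res !natrD; ring.
have [core_inv coreK invK] := core_of_bij.
exists core_of, (fun g c => core_of (g (core_inv c))); split=> //.
- exact: core_of_bij.
- split=> [g h _ _ gh c|c|g h _ _ c] /=; first by rewrite gh.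
    exact: invK.
  by rewrite coreK.
- move=> c; rewrite -{1 3 6}(invK c); move: (core_inv c) => q; split.
  + exact: toggles_lam0.
  + exact: toggles_lam1.
  + exact: lam_gen2.
- by move=> g q _; rewrite coreK.
Qed.
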